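(* Let $0<a<b$ be real numbers. Then $$e^{2(a-b)}\left(\frac{a}{b}\right)\leq \frac{B(b,b)}{B(a,a)}\leq e^{a-b}\left(\frac{a}{b}\right)\left(\frac{2b+1}{2a+1}\right)^{\frac{1}{2}}.$$
   Context: For real $x,y>0$, $B(x,y)=\int_0^1 t^{x-1}(1-t)^{y-1}\,dt$ denotes the (Euler) beta function. *)

(* Defs.v *)
From mathcomp Require Import all_boot all_order all_algebra.
From mathcomp Require Import all_classical all_reals all_analysis.

Set Implicit Arguments.
Unset Strict Implicit.
Unset Printing Implicit Defensive.

Import Order.TTheory GRing.Theory Num.Theory.
Import numFieldNormedType.Exports.

Local Open Scope classical_set_scope.
Local Open Scope ring_scope.

(* The library's [beta_fun] only takes parameters in [nat].  The interval is
   open because the integrand is singular at 0 (resp. 1) when x < 1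
   (resp. y < 1).  For x, y > 0 the integral is finite, so the default value
   0 that [Rintegral] gives to an infinite integral plays no role. *)
Definition euler_beta (R : realType) (x y : R) : R :=
  \int[lebesgue_measure]_(t in `]0, 1[) (t `^ (x - 1) * (1 - t) `^ (y - 1)).

(* Main.v *)
(* Write w = t (1 - t), so that B(x,x) is the integral of w^(x-1), and d = b - a.
   Integrating the derivative of w^x (1 - 2t) over ]0, 1[ gives
   B(x+1,x+1) = x / (2 (2x+1)) B(x,x), hence for G(x) = x B(x,x) the recurrence
   G(x+1) = (x+1) / (2 (2x+1)) G(x).

   Lower bound, i.e. G(x) <= exp(2d) G(x+d): since (x+1) / (2 (2x+1)) decreases
   in x, the inequality at x+1 implies the one at x, so x >= 3 may be assumed.
   There it follows by integrating u^d >= 1 + d (1 - 1/u) with u = exp(2) w,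
   because B(x,x) / B(x-1,x-1) >= 1/5 >= exp(-2).

   Upper bound: K(x) = G(x)^2 / (2x+1) satisfies K(x+1) = K(x) q(x) / 4 with
   q(x) = (x+1)^2 / ((2x+1) (2x+3)), and for x >= n,
   q(x) / q(x+d) <= exp(2d / ((n+1) (2n+1) (2n+3))).  These exponents are
   summable with sum 2d (2 ln 2 - 1), while w <= 1/4 bounds K(x+d) / K(x) by
   (1 + d/x)^2 16^-d.  Shifting a and b = a + d by n and letting n tend to
   infinity yields K(b) <= exp(-2d) K(a). *)

Require Import Defs.
From mathcomp Require Import all_boot all_order all_algebra.
From mathcomp Require Import all_classical all_reals all_analysis.
From mathcomp Require Import measurable_realfun ring lra.

Import Order.TTheory GRing.Theory Num.Theory.
Import numFieldNormedType.Exports.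

Local Open Scope classical_set_scope.
Local Open Scope ring_scope.

(* [u^d = exp (d ln u) >= 1 + d ln u >= 1 + d (1 - 1/u)] *)
Lemma powR_ge1D (R : realType) (u d : R) : 0 < u -> 0 <= d ->
  1 + d * (1 - u^-1) <= u `^ d.
Proof.
move=> u0 d0; rewrite /powR gt_eqF//; apply: le_trans (expR_ge1Dx _).
have u'0 : 0 < u^-1 by rewrite invr_gt0.
rewrite lerD2l ler_wpM2l//; have := @le_ln1Dx R (u^-1 - 1).
rewrite (_ : 1 + (u^-1 - 1) = u^-1); last by ring.
by rewrite lnV ?posrE// => /(_ ltac:(lra)); lra.
Qed.

(** * Powers of [w t] and their integrals over the open unit interval *)

Section central_beta.
Context {R : realType}.
Implicit Types s t x y d : R.

Local Notation mu := (@lebesgue_measure R).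
Local Notation w t := (t * (1 - t)).
Local Notation W s := (fun t : R => w t `^ s).
Local Notation B x := (euler_beta x x).

Lemma mul_onem_gt0 t : t \in `]0, 1[ -> 0 < w t.
Proof. by rewrite in_itv/= => /andP[t0 t1]; rewrite mulr_gt0// subr_gt0. Qed.

Lemma mul_onem_le t : w t <= 4^-1.
Proof. by have := sqr_ge0 (t - 2^-1); rewrite expr2; lra. Qed.

Lemma euler_beta_diag x :
  B x = \int[mu]_(t in `]0, 1[) w t `^ (x - 1).
Proof.
apply: eq_Rintegral => t; rewrite inE/= in_itv/= => /andP[t0 t1].
by rewrite powRM ?ltW// subr_gt0.
Qed.

Lemma measurable_powR_mul_onem (D : set R) s : measurable_fun D (W s).
Proof.
apply: measurable_funTS.
apply: (measurableT_comp (measurable_powR s)).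
by apply: measurable_funM => //; exact: measurable_funB.
Qed.

Lemma is_derive_powR_mul_onem s t : t \in `]0, 1[ ->
  is_derive t 1 (W s) (s * w t `^ (s - 1) * (1 - 2 * t)).
Proof.
move=> /mul_onem_gt0 /(is_derive1_powR s) h.
have dw : is_derive t 1 (fun t : R => w t) (1 - 2 * t).
  by apply: is_derive_eq; rewrite /GRing.scale/=; ring.
exact: (@is_derive1_comp _ (fun u : R => u `^ s) (fun t : R => w t) t _ _ h dw).
Qed.

Lemma is_derive_powR_mul_onem_sub s t : t \in `]0, 1[ ->
  is_derive t 1 (fun t => w t `^ s * (1 - 2 * t))
    (s * w t `^ (s - 1) - (4 * s + 2) * w t `^ s).
Proof.
move=> t01; have w0 := mul_onem_gt0 _ t01.
have wE : w t `^ s = w t * w t `^ (s - 1).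
  rewrite -{2}(powRr1 (ltW w0)) -powRD ?(gt_eqF w0) ?implybT//.
  by congr (_ `^ _); ring.
have dW := is_derive_powR_mul_onem s t t01.
by apply: is_derive_eq; rewrite /GRing.scale/= wE; ring.
Qed.

(** * Truncation away from the endpoints, integrability and the recurrence *)

(** The compact intervals from [cut n] to [1 - cut n] avoid the endpoints, where [W s] is singular
    for negative [s]. The offset 3 keeps [cut n] below 1/2, so they are never degenerate. *)
Let cut n : R := n.+3%:R^-1.

Let cut_gt0 n : 0 < cut n.
Proof. by rewrite invr_gt0 ltr0n. Qed.

Let cut_lt n : cut n < 2^-1.
Proof. by rewrite ltf_pV2 ?posrE ?ltr0n// ltr_nat. Qed.

Let cut_sub n : `[cut n, 1 - cut n] `<=` `]0, 1[.
Proof.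
move=> t /=; rewrite !in_itv/= => /andP[t0 t1].
by have := cut_gt0 n; lra.
Qed.

Let cut_nd : nondecreasing_seq (fun n => `[cut n, 1 - cut n]%classic).
Proof.
apply/nondecreasing_seqP => n; rewrite subsetEset => t /=.
rewrite !in_itv/= => /andP[t0 t1].
suff : cut n.+1 <= cut n by lra.
by rewrite lef_pV2 ?posrE ?ltr0n// ler_nat.
Qed.

Let bigcup_cut : \bigcup_n `[cut n, 1 - cut n]%classic = `]0, 1[%classic.
Proof.
apply/seteqP; split; first by apply: bigcup_sub => n _; exact: cut_sub.
move=> t; rewrite /= in_itv/= => /andP[t0 t1].
have m0 : 0 < Num.min t (1 - t) by rewrite lt_min t0 subr_gt0.
have [n nP] := ltr_add_invr m0.
exists n => //=; rewrite in_itv/=.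
suff : cut n <= Num.min t (1 - t).
  by rewrite le_min => /andP[? ?]; lra.
apply/ltW/(le_lt_trans _ nP); rewrite add0r.
rewrite lef_pV2 ?posrE ?ltr0n// ler_nat; exact/leqW/leqW.
Qed.

Let powR_mul_onem_continuous s n :
  {within `[cut n, 1 - cut n], continuous (W s)}.
Proof.
apply: derivable_within_continuous => t /cut_sub /= t01.
by case: (is_derive_powR_mul_onem s t t01).
Qed.

Let integrable_cut s n : mu.-integrable `[cut n, 1 - cut n] (EFin \o W s).
Proof.
apply: continuous_compact_integrable => //; exact: segment_compact.
Qed.

Let J s n := \int[mu]_(t in `[cut n, 1 - cut n]) W s t.

Let cut_recurrence s n :
  s * J (s - 1) n =
  (4 * s + 2) * J s n - 2 * (1 - 2 * cut n) * W s (cut n).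
Proof.
have c0 := cut_gt0 n; have c1 := cut_lt n.
have ii : mu.-integrable `[cut n, 1 - cut n]
    (EFin \o (fun t => s * W (s - 1) t)).
  by apply: (@integrableZl _ _ _ mu _ _ s (EFin \o W (s - 1))).
have ij : mu.-integrable `[cut n, 1 - cut n]
    (EFin \o (fun t => (4 * s + 2) * W s t)).
  by apply: (@integrableZl _ _ _ mu _ _ (4 * s + 2) (EFin \o W s)).
suff : \int[mu]_(t in `[cut n, 1 - cut n])
    (s * W (s - 1) t - (4 * s + 2) * W s t) =
    - 2 * (1 - 2 * cut n) * W s (cut n).
  rewrite RintegralB// !RintegralZl// => h.
  by rewrite -[LHS](subrK ((4 * s + 2) * J s n)) h; ring.
rewrite /Rintegral (@continuous_FTC2 _ _
  (fun t => w t `^ s * (1 - 2 * t))); last 4 first.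
- lra.
- move=> t; apply: cvgB; apply: cvgM; try exact: cvg_cst;
  exact: powR_mul_onem_continuous.
- have cF : forall t, t \in `]0, 1[ ->
     {for t, continuous (fun t => w t `^ s * (1 - 2 * t))}.
    move=> t t01; apply: differentiable_continuous.
    by apply/derivable1_diffP; case: (is_derive_powR_mul_onem_sub s t t01).
  split.
  + move=> t /subset_itv_oo_cc/cut_sub/= t01.
    by case: (is_derive_powR_mul_onem_sub s t t01).
  + by apply/cvg_at_right_filter/cF; rewrite in_itv/=; lra.
  + by apply/cvg_at_left_filter/cF; rewrite in_itv/=; lra.
- move=> t /subset_itv_oo_cc/cut_sub/= t01.
  by rewrite derive1E; case: (is_derive_powR_mul_onem_sub s t t01).
- rewrite -EFinB/= (_ : (1 - cut n) * (1 - (1 - cut n)) = w (cut n)); ring.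
Qed.

(** Monotone convergence along the increasing truncations. The limit is an extended real because
    finiteness for negative [s] is not yet known. *)
Let J_cvg s : (J s n)%:E @[n --> \oo] -->
  (\int[mu]_(t in `]0%R, 1%R[) (W s t)%:E)%E.
Proof.
rewrite -bigcup_cut.
have -> : (fun n => (J s n)%:E) = (fun n =>
    (\int[mu]_(t in `[cut n, (1 - cut n)%R]%classic) (W s t)%:E)%E).
  apply/funext => n; rewrite /J /Rintegral fineK//.
  by apply: integrable_fin_num => //; exact: integrable_cut.
apply: ge0_nondecreasing_set_cvg_integral => //.
- by move=> n; apply/measurable_EFinP; exact: measurable_powR_mul_onem.
- by move=> n t _; rewrite lee_fin powR_ge0.
Qed.

Let integrable_powR_ge0 s : 0 <= s ->
  mu.-integrable `]0, 1[ (EFin \o W s).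
Proof.
move=> s0; apply: (@le_integrable _ _ _ mu _ _ _ (EFin \o cst 1)) => //=.
- by apply/measurable_EFinP; exact: measurable_powR_mul_onem.
- move=> t t01; rewrite lee_fin ger0_norm ?powR_ge0// normr1.
  have w0 := mul_onem_gt0 _ t01.
  have w1 : 0 < w t <= 1 by have := mul_onem_le t; rewrite w0; lra.
  by have := ger_powR w1 s0; rewrite powRr0.
- apply: measurable_bounded_integrable => //.
    by rewrite /= lebesgue_measure_itv/= lte_fin ltr01 -EFinB ltry.
  exact: bounded_cst.
Qed.

Let powR_cut_cvg0 s : 0 < s -> W s (cut n) @[n --> \oo] --> 0.
Proof.
move=> s0.
have cut0 : cut n @[n --> \oo] --> 0.
  rewrite (cvg_shiftS (fun n => n.+2%:R^-1 : R^o)).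
  by rewrite (cvg_shiftS (fun n => n.+1%:R^-1 : R^o)); exact: cvg_harmonic.
have /cvg_at_rightP/(_ cut (conj cut_gt0 cut0)) cutX := powR_cvg0 s0.
apply: (squeeze_cvgr _ (cvg_cst 0) cutX).
apply: nearW => n; have c0 := cut_gt0 n; have c1 := cut_lt n.
rewrite powR_ge0/= ge0_ler_powR ?nnegrE ?mulr_ge0//; first [lra | nra | idtac].
Qed.

(** Limit of [cut_recurrence], whose boundary term vanishes. The right side is finite since [W s] is
    bounded, so this also yields integrability of the possibly singular [W (s - 1)]. *)
Let integral_powR_mul_onem s : 0 < s ->
  (\int[mu]_(t in `]0%R, 1%R[) (W (s - 1) t)%:E =
   ((4 * s + 2) / s * \int[mu]_(t in `]0%R, 1%R[) W s t)%R%:E)%E.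
Proof.
move=> s0; apply: (cvg_unique _ (@J_cvg (s - 1))) => //.
have Jc : J s n @[n --> \oo] --> \int[mu]_(t in `]0, 1[) W s t.
  have := @J_cvg s.
  rewrite -[X in _ --> X]fineK ?integrable_fin_num//; last first.
    exact/integrable_powR_ge0/ltW.
  by move=> /fine_cvgP[].
apply: cvg_EFin; first exact: nearW.
have -> : fine \o (fun n => (J (s - 1) n)%:E) = fun n =>
    (4 * s + 2) / s * J s n - 2 / s * (1 - 2 * cut n) * W s (cut n).
  apply/funext => n /=; apply: (@mulfI _ s); first by rewrite gt_eqF.
  by rewrite cut_recurrence; field; rewrite gt_eqF.
rewrite -[X in _ --> X]subr0; apply: cvgB; first exact: cvgMr.
have W0 : 2 / s * W s (cut n) @[n --> \oo] --> 0.
  by rewrite -(mulr0 (2 / s)); apply: cvgMr; exact: powR_cut_cvg0.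
apply: (squeeze_cvgr _ (cvg_cst 0) W0).
apply: nearW => n; have c0 := cut_gt0 n; have c1 := cut_lt n.
have s20 : 0 <= 2 / s by rewrite divr_ge0// ltW.
apply/andP; split.
  by rewrite !mulr_ge0 ?powR_ge0//; lra.
rewrite ler_wpM2r ?powR_ge0// ler_piMr//; lra.
Qed.

Lemma integrable_powR_mul_onem x : 0 < x ->
  mu.-integrable `]0, 1[ (EFin \o W (x - 1)).
Proof.
move=> x0; apply/integrableP; split.
  by apply/measurable_EFinP; exact: measurable_powR_mul_onem.
under eq_integral => t _ do rewrite /= ger0_norm ?powR_ge0//.
by rewrite integral_powR_mul_onem ?ltry.
Qed.

Lemma euler_betaS x : 0 < x ->
  B (x + 1) = x / (2 * (2 * x + 1)) * B x.
Proof.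
move=> x0; rewrite !euler_beta_diag addrK /Rintegral.
rewrite [in RHS]integral_powR_mul_onem//=.
by rewrite /Rintegral; field; apply/andP; split; rewrite gt_eqF//; lra.
Qed.

(** * Comparing the beta integral at [x] and [x + d]; positivity *)

Lemma euler_betaD_le x d : 0 < x -> 0 <= d -> B (x + d) <= 4^-1 `^ d * B x.
Proof.
move=> x0 d0; have xd0 : 0 < x + d by rewrite ltr_pwDl.
rewrite !euler_beta_diag -RintegralZl//; last exact: integrable_powR_mul_onem.
apply: le_Rintegral => //.
- exact: integrable_powR_mul_onem.
- apply: (@integrableZl _ _ _ mu _ _ _ (EFin \o W (x - 1))) => //.
  exact: integrable_powR_mul_onem.
- move=> t t01; have w0 := mul_onem_gt0 _ t01.
  have -> : x + d - 1 = d + (x - 1) by ring.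
  rewrite powRD ?(gt_eqF w0) ?implybT// ler_wpM2r ?powR_ge0//.
  by rewrite ge0_ler_powR ?nnegrE ?mul_onem_le ?(ltW w0)//; lra.
Qed.

(** Integrating [powR_ge1D] leaves the first-order term [d * (B x - expR (- 2) * B (x - 1))], which
    the last hypothesis makes nonnegative. *)
Lemma euler_betaD_ge x d : 1 < x -> 0 <= d ->
  expR (- 2) * B (x - 1) <= B x -> B x <= expR (2 * d) * B (x + d).
Proof.
move=> x1 d0 hB; have x0 : 0 < x by exact: lt_trans x1.
have xd0 : 0 < x + d by rewrite ltr_pwDl.
have x10 : 0 < x - 1 by rewrite subr_gt0.
have -> : expR (2 * d) * B (x + d) =
    \int[mu]_(t in `]0, 1[) (expR (2 * d) * W (x + d - 1) t).
  rewrite euler_beta_diag RintegralZl//.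
  exact: integrable_powR_mul_onem.
have i1 : mu.-integrable `]0, 1[ (EFin \o (fun t => (1 + d) * W (x - 1) t)).
  apply: (@integrableZl _ _ _ mu _ _ _ (EFin \o W (x - 1))) => //.
  exact: integrable_powR_mul_onem.
have i2 : mu.-integrable `]0, 1[
    (EFin \o (fun t => (d * expR (- 2)) * W (x - 1 - 1) t)).
  apply: (@integrableZl _ _ _ mu _ _ _ (EFin \o W (x - 1 - 1))) => //.
  exact: integrable_powR_mul_onem.
suff : \int[mu]_(t in `]0, 1[)
    ((1 + d) * W (x - 1) t - (d * expR (- 2)) * W (x - 1 - 1) t) <=
    \int[mu]_(t in `]0, 1[) (expR (2 * d) * W (x + d - 1) t).
  apply: le_trans; rewrite RintegralB// !RintegralZl//;
    try exact: integrable_powR_mul_onem.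
  rewrite -!euler_beta_diag.
  move: hB; move: (B x) (B (x - 1)) => p q hB.
  rewrite -subr_ge0 (_ : _ - _ = d * (p - expR (- 2) * q)); last by ring.
  by rewrite mulr_ge0 ?subr_ge0.
apply: le_Rintegral => //.
- exact: (integrableB _ i1 i2).
- apply: (@integrableZl _ _ _ mu _ _ _ (EFin \o W (x + d - 1))) => //.
  exact: integrable_powR_mul_onem.
move=> t t01; have w0 := mul_onem_gt0 _ t01.
have wE : W (x - 1) t = w t * W (x - 1 - 1) t.
  rewrite -{2}(powRr1 (ltW w0)) -powRD ?(gt_eqF w0) ?implybT//.
  by congr (_ `^ _); ring.
have -> : x + d - 1 = d + (x - 1) by ring.
rewrite (powRD (r := d)) ?(gt_eqF w0) ?implybT// wE.
set v := W (x - 1 - 1) t; have v0 : 0 <= v by exact: powR_ge0.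
set u := expR 2 * w t.
have u0 : 0 < u by rewrite mulr_gt0 ?expR_gt0.
have -> : expR (2 * d) * (w t `^ d * (w t * v)) = u `^ d * (w t * v).
  by rewrite expRM (powRM _ (expR_ge0 _) (ltW w0)) mulrA.
have -> : w t = expR (- 2) * u by rewrite /u mulrA -expRD addNr expR0 mul1r.
(* With [w t = expR (- 2) * u], the integrand on the left is the lower bound of [powR_ge1D] times a
   nonnegative weight. *)
rewrite (_ : _ - _ = expR (- 2) * u * v * (1 + d * (1 - u^-1))).
  by rewrite [leRHS]mulrC ler_wpM2l ?powR_ge1D// mulr_ge0// mulr_ge0// ltW.
by field; rewrite gt_eqF.
Qed.

(** At positive integers, positivity follows from [B 1 = 1] and the recurrence; [euler_betaD_le]
    carries it down from an integer above [x]. *)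
Lemma euler_beta_gt0 x : 0 < x -> 0 < B x.
Proof.
move=> x0.
have natB (n : nat) : 0 < B (n.+1%:R : R).
  elim: n => [|n IH]; last first.
    have n0 : 0 < n.+1%:R :> R by [].
    have -> : n.+2%:R = n.+1%:R + 1 :> R by rewrite natr1.
    rewrite euler_betaS//.
    by rewrite mulr_gt0// divr_gt0// mulr_gt0// ltr_wpDl// mulr_ge0.
  rewrite euler_beta_diag subrr.
  under eq_Rintegral do rewrite powRr0.
  rewrite Rintegral_cst//= lebesgue_measure_itv/= lte_fin ltr01 /= mul1r; lra.
have [n xn] : exists n, x <= n.+1%:R.
  exists (Num.truncn x); exact/ltW/truncnS_gt.
have := euler_betaD_le x (n.+1%:R - x) x0; rewrite subr_ge0 => /(_ xn).
rewrite addrC subrK => /(lt_le_trans (natB n)).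
by rewrite pmulr_rgt0// powR_gt0// invr_gt0.
Qed.

End central_beta.

(** * The lower bound *)

Section beta_ratio.
Context {R : realType}.
Implicit Types a b x y d : R.

Local Notation B x := (euler_beta x x).

Lemma expRN2_le : expR (- 2) <= 5^-1 :> R.
Proof.
rewrite expRN lef_pV2 ?posrE ?expR_gt0//.
(* [expR 2] is the fourth power of [expR 2^-1 >= 3/2], and 81/16 exceeds 5. *)
have -> : 2 = 4%:R * 2^-1 :> R by lra.
rewrite expRM_natl; apply: (@le_trans _ _ ((1 + 2^-1) ^+ 4)).
  by rewrite !exprS expr0; lra.
by rewrite lerXn2r ?nnegrE ?expR_ge0 ?expR_ge1Dx//; lra.
Qed.

Lemma euler_beta_ratio_lower_ge3 x d : 3 <= x -> 0 <= d ->
  B x <= expR (2 * d) * B (x + d).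
Proof.
move=> x3 d0; apply: euler_betaD_ge => //; first lra.
have x10 : 0 < x - 1 by lra.
have := euler_betaS _ x10; rewrite subrK => ->.
rewrite ler_wpM2r ?(ltW (euler_beta_gt0 _ x10))//.
apply: le_trans expRN2_le _.
(* The ratio [(x - 1) / (2 * (2 * x - 1))] is at least 1/5 exactly when [3 <= x]; hence the
   threshold 3. *)
by rewrite ler_pdivlMr; lra.
Qed.

Lemma euler_beta_ratio_lower x d : 0 < x -> 0 <= d ->
  x * B x <= expR (2 * d) * ((x + d) * B (x + d)).
Proof.
move=> x0 d0; have [n] : exists n : nat, 3 <= x + n%:R by exists 3%N; lra.
elim: n x x0 => [|n IH] x x0 xn.
  have x3 : 3 <= x by lra.
  rewrite mulrCA; apply: ler_pM => //; [exact: ltW | | lra |].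
    by rewrite ltW ?euler_beta_gt0.
  exact: euler_beta_ratio_lower_ge3.
have xd0 : 0 < x + d by lra.
pose r y := (y + 1) / (2 * (2 * y + 1)).
have r0 : 0 < r x by rewrite divr_gt0; lra.
have rE y : 0 < y -> (y + 1) * (y / (2 * (2 * y + 1)) * B y) = r y * (y * B y).
  by move=> y0; rewrite /r; ring.
have := IH (x + 1); rewrite -addrA nat1r => /(_ (addr_gt0 x0 ltr01) xn).
rewrite addrAC !euler_betaS// !rE// => h.
rewrite -(ler_pM2l r0); apply: le_trans h _.
rewrite [leRHS]mulrCA ler_wpM2l ?expR_ge0// ler_wpM2r//.
  by rewrite mulr_ge0 ?ltW ?euler_beta_gt0.
rewrite /r ler_pdivrMr; last lra.
rewrite mulrAC ler_pdivlMr; last lra.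
(* [r (x + d) <= r x]: with denominators cleared, the gap is [2 * d]. *)
by rewrite -subr_ge0 (_ : _ - _ = 2 * d); [lra | ring].
Qed.

(** * Harmonic sums and [ln 2] *)

Definition harmonic_sum n : R := \sum_(k < n) k.+1%:R^-1.

Lemma harmonic_sumS n :
  harmonic_sum n.+1 = harmonic_sum n + n.+1%:R^-1.
Proof. by rewrite /harmonic_sum big_ord_recr. Qed.

(** The sequence [harmonic_sum k - ln k] is nonincreasing, by [ln (1 - 1/k) <= - 1/k]. *)
Lemma harmonic_sum_ln n m :
  harmonic_sum (n.+1 + m) - ln (n.+1 + m)%:R <=
  harmonic_sum n.+1 - ln n.+1%:R.
Proof.
elim: m => [|m IH]; first by rewrite addn0.
apply: le_trans IH; rewrite addnS harmonic_sumS addSn.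
set k := (n + m)%N.
have k1 : 0 < k.+1%:R :> R by [].
have k2 : 0 < k.+2%:R :> R by [].
have := @le_ln1Dx R (- k.+2%:R^-1).
rewrite (_ : 1 - k.+2%:R^-1 = k.+1%:R / k.+2%:R); last first.
  have -> : k.+2%:R = k.+1%:R + 1 :> R by rewrite natr1.
  by field; rewrite gt_eqF//; lra.
rewrite ln_div ?posrE// ltrN2 invf_lt1// ltr1n => /(_ isT).
move: (ln _) (ln _) (harmonic_sum _) (_^-1) => *; lra.
Qed.

Lemma harmonic_sum_double n :
  harmonic_sum n.+1.*2 - harmonic_sum n.+1 <= ln 2.
Proof.
have := harmonic_sum_ln n n.+1; rewrite addnn -muln2 natrM lnM ?posrE//.
lra.
Qed.

(** * The upper bound *)

Let K x := (x * B x) ^+ 2 / (2 * x + 1).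

Let q x := (x + 1) ^+ 2 / ((2 * x + 1) * (2 * x + 3)).

Let K_gt0 x : 0 < x -> 0 < K x.
Proof.
move=> x0; rewrite divr_gt0//; last lra.
by rewrite exprn_gt0// mulr_gt0// euler_beta_gt0.
Qed.

Let KS x : 0 < x -> K (x + 1) = K x * (q x / 4).
Proof.
move=> x0; rewrite /K /q euler_betaS//; field.
by rewrite !gt_eqF//; lra.
Qed.

(** The factor of [d] in the exponent is minus the logarithmic derivative of [q] at [x], which
    decreases in [x], so the bound at [y] is relaxed to one at [x]. *)
Let q_le x y d : 0 <= x -> x <= y -> 0 <= d ->
  q y <= expR (2 * d / ((x + 1) * (2 * x + 1) * (2 * x + 3))) * q (y + d).
Proof.
move=> x0 xy d0; have y0 : 0 <= y by exact: le_trans xy.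
have qd0 : 0 <= q (y + d).
  by rewrite divr_ge0 ?sqr_ge0// mulr_ge0//; lra.
apply: (@le_trans _ _
  ((1 + 2 * d / ((y + 1) * (2 * y + 1) * (2 * y + 3))) * q (y + d))).
  rewrite -subr_ge0 (_ : _ - _ = d ^+ 2 * (3 * (y + 1) + 2 * d) /
    ((y + 1) * (2 * y + 1) * (2 * y + 3) *
     ((2 * (y + d) + 1) * (2 * (y + d) + 3)))).
    by rewrite divr_ge0 ?mulr_ge0 ?sqr_ge0//; lra.
  by rewrite /q; field; rewrite !gt_eqF//; lra.
rewrite ler_wpM2r//; apply: le_trans (expR_ge1Dx _) _; rewrite ler_expR.
rewrite ler_wpM2l ?mulr_ge0// lef_pV2 ?posrE ?mulr_gt0//; try lra.
by rewrite !ler_pM ?mulr_ge0//; lra.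
Qed.

(* A closed form of the sum of 1 / ((k+1) (2k+1) (2k+3)) over k < n. *)
Let c (n : nat) : R :=
  2 * (harmonic_sum n.*2 - harmonic_sum n) + (2 * n%:R + 1)^-1 - 1.

Let cS n : c n.+1 =
  c n + ((n%:R + 1) * (2 * n%:R + 1) * (2 * n%:R + 3))^-1.
Proof.
rewrite /c doubleS !harmonic_sumS.
have -> : n.*2.+2%:R = 2 * n%:R + 2 :> R.
  by rewrite -muln2 -addn2 natrD natrM mulrC.
have -> : n.*2.+1%:R = 2 * n%:R + 1 :> R.
  by rewrite -muln2 -addn1 natrD natrM mulrC.
have -> : n.+1%:R = n%:R + 1 :> R by rewrite natr1.
have n0 : 0 <= n%:R :> R by [].
move: (harmonic_sum _) (harmonic_sum _) => h1 h2.
by field; rewrite !gt_eqF//; lra.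
Qed.

Let c_le n : c n.+1 <= 2 * ln 2 - 1 + n.+1%:R^-1.
Proof.
have := harmonic_sum_double n; rewrite /c.
suff : (2 * n.+1%:R + 1)^-1 <= n.+1%:R^-1 :> R.
  move: (ln _) (harmonic_sum _) (harmonic_sum _) (_^-1) (_^-1) => *; lra.
have n0 : 0 < n.+1%:R :> R by [].
by rewrite lef_pV2 ?posrE//; lra.
Qed.

(** Iterates [KS], using [q_le] at step [n] with base point [n <= a + n]; this makes the accumulated
    exponent [c n] independent of [a]. *)
Let K_shift a d n : 0 < a -> 0 <= d ->
  K (a + d) * K (a + n%:R) <=
  expR (2 * d * c n) * (K (a + d + n%:R) * K a).
Proof.
move=> a0 d0; elim: n => [|n IH].
  rewrite /c double0 subrr mulr0n !(mulr0, add0r) invr1 subrr mulr0 expR0 mul1r.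
  by rewrite !addr0.
have n0 : 0 <= n%:R :> R by [].
have -> : n.+1%:R = n%:R + 1 :> R by rewrite natr1.
rewrite !addrA !KS; try lra.
have K0 x : 0 < x -> 0 <= K x by move=> /K_gt0/ltW.
have q0 x : 0 <= x -> 0 <= q x.
  by move=> x0; rewrite divr_ge0 ?sqr_ge0// mulr_ge0//; lra.
have nan : n%:R <= a + n%:R by lra.
have KK0 : 0 <= K (a + d) * K (a + n%:R) by rewrite mulr_ge0// K0//; lra.
have qn0 : 0 <= q (a + n%:R) by rewrite q0//; lra.
have h := ler_pM KK0 qn0 IH (q_le _ _ d n0 nan d0).
have -> : K (a + d) * (K (a + n%:R) * (q (a + n%:R) / 4)) =
  K (a + d) * K (a + n%:R) * q (a + n%:R) / 4 by ring.
rewrite ler_pdivrMr//; apply: le_trans h _.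
rewrite cS (mulrDr _ (c n)) expRD (addrAC a n%:R d).
by rewrite le_eqVlt; apply/orP; left; apply/eqP; field.
Qed.

Let K_tail a d n : 0 < a -> 0 <= d ->
  K (a + d + n.+1%:R) <=
  expR (2 * d / n.+1%:R - 4 * d * ln 2) * K (a + n.+1%:R).
Proof.
move=> a0 d0; have n0 : 0 < n.+1%:R :> R by [].
have an0 : 0 < a + n.+1%:R by rewrite addr_gt0.
have ny : n.+1%:R <= a + n.+1%:R by rewrite lerDr ltW.
rewrite addrAC; move: (a + n.+1%:R) an0 ny => y y0 ny.
have yd0 : 0 < y + d by rewrite ltr_pwDl.
have y1 : (2 * (y + d) + 1)^-1 <= (2 * y + 1)^-1.
  by rewrite lef_pV2 ?posrE; lra.
have y'0 : 0 <= (2 * (y + d) + 1)^-1 by rewrite invr_ge0; lra.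
have yd : y + d <= expR (d / n.+1%:R) * y.
  apply: (@le_trans _ _ ((1 + d / n.+1%:R) * y)); last first.
    by rewrite ler_wpM2r ?expR_ge1Dx// ltW.
  rewrite mulrDl mul1r lerD2l -mulrA ler_peMr//.
  by rewrite mulrC ler_pdivlMr// mul1r.
have e4 : 4^-1 `^ d = expR (- (2 * d * ln 2)).
  rewrite /powR gt_eqF ?invr_gt0//= lnV ?posrE//.
  rewrite (_ : 4 = 2 ^+ 2 :> R); last by rewrite expr2 -natrM.
  by rewrite lnXn//; congr expR; ring.
have ydB : 0 <= (y + d) * B (y + d).
  by apply/mulr_ge0; apply/ltW => //; exact: euler_beta_gt0.
have -> : 2 * d / n.+1%:R - 4 * d * ln 2 =
  2%:R * (d / n.+1%:R - 2 * d * ln 2) by ring.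
rewrite /K mulrA expRM_natl -exprMn expRD.
apply: ler_pM (sqr_ge0 _) y'0 _ y1.
rewrite lerXn2r ?nnegrE//; first last.
  rewrite mulrACA -e4.
  exact: ler_pM (ltW yd0) (ltW (euler_beta_gt0 _ yd0)) yd
    (euler_betaD_le _ _ y0 d0).
by rewrite !mulr_ge0 ?expR_ge0// ltW ?euler_beta_gt0.
Qed.

(** In the product of [K_shift] and [K_tail] the [ln 2] terms cancel, leaving [- 2 * d] and two
    errors [2 * d / n.+1%:R], one from [c_le] and one from [K_tail]. *)
Let K_le_eps a d n : 0 < a -> 0 <= d ->
  K (a + d) <= expR (4 * d / n.+1%:R - 2 * d) * K a.
Proof.
move=> a0 d0; have n0 : 0 < n.+1%:R :> R by [].
have an0 : 0 < a + n.+1%:R by lra.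
rewrite -(ler_pM2r (K_gt0 _ an0)); apply: le_trans (K_shift _ _ n.+1 a0 d0) _.
have Ka := K_gt0 _ a0.
have K0 : 0 <= K (a + d + n.+1%:R) * K a.
  by rewrite mulr_ge0// ltW// K_gt0// addr_gt0// ltr_pwDl.
have d20 : 0 <= 2 * d by exact: mulr_ge0.
have cn : expR (2 * d * c n.+1) <= expR (2 * d * (2 * ln 2 - 1 + n.+1%:R^-1)).
  by rewrite ler_expR ler_wpM2l.
apply: le_trans (ler_pM (expR_ge0 _) K0 cn
  (ler_wpM2r (ltW Ka) (K_tail _ _ n a0 d0))) _.
have -> : 4 * d / n.+1%:R - 2 * d =
  2 * d * (2 * ln 2 - 1 + n.+1%:R^-1) + (2 * d / n.+1%:R - 4 * d * ln 2) by ring.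
rewrite [in leRHS]expRD.
move: (expR _) (expR _) (K a) (K _) => e1 e2 k1 k2.
by rewrite [leLHS](_ : _ = e2 * e1 * k1 * k2); last by ring.
Qed.

Lemma euler_beta_ratio_upper a d : 0 < a -> 0 <= d ->
  ((a + d) * B (a + d)) ^+ 2 / (2 * (a + d) + 1) <=
  expR (- (2 * d)) * ((a * B a) ^+ 2 / (2 * a + 1)).
Proof.
move=> a0 d0; rewrite -[leLHS]/(K (a + d)) -[X in _ * X]/(K a).
have lim : expR (4 * d * n.+1%:R^-1 - 2 * d) * K a @[n --> \oo] -->
    expR (4 * d * 0 - 2 * d) * K a.
  apply: cvgMl; apply: continuous_cvg; first exact: continuous_expR.
  apply: cvgB; last exact: cvg_cst.
  by apply: cvgMr; exact: cvg_harmonic.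
rewrite mulr0 sub0r in lim.
apply: (cvgr_to_ge lim); apply: nearW => n; exact: K_le_eps.
Qed.

End beta_ratio.

(** * Both bounds, with [d = b - a] *)

Theorem theorem2p15 (R : realType) (a b : R) (ha : 0 < a) (hab : a < b) :
  expR (2 * (a - b)) * (a / b) <= euler_beta b b / euler_beta a a /\
  euler_beta b b / euler_beta a a <=
    expR (a - b) * (a / b) * ((2 * b + 1) / (2 * a + 1)) `^ (1 / 2).
Proof.
have d0 : 0 <= b - a by rewrite subr_ge0 ltW.
have ab : a + (b - a) = b by ring.
have b0 : 0 < b by exact: lt_trans hab.
have Ba := euler_beta_gt0 _ ha; have Bb := euler_beta_gt0 _ b0.
split.
  have := euler_beta_ratio_lower a (b - a) ha d0; rewrite ab.
  move: (euler_beta a a) (euler_beta b b) Ba Bb => p q p0 q0 h.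
  have -> : expR (2 * (a - b)) = (expR (2 * (b - a)))^-1.
    by rewrite -expRN; congr expR; ring.
  rewrite ler_pdivlMr//; move: (expR _) (expR_gt0 (2 * (b - a))) h => E E0 h.
  rewrite (_ : _ * p = a * p / (b * E)); last by field; rewrite !gt_eqF.
  by rewrite ler_pdivrMr ?mulr_gt0// (_ : q * _ = E * (b * q)); last by ring.
have := euler_beta_ratio_upper a (b - a) ha d0; rewrite ab.
move: (euler_beta a a) (euler_beta b b) Ba Bb => p q p0 q0 h.
have a1 : 0 < 2 * a + 1 by lra.
have b1 : 0 < 2 * b + 1 by lra.
have r0 : 0 <= (2 * b + 1) / (2 * a + 1) by rewrite divr_ge0// ltW.
rewrite div1r powR12_sqrt//.
set s := Num.sqrt _.
have s2 : s ^+ 2 = (2 * b + 1) / (2 * a + 1) by rewrite sqr_sqrtr.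
have s0 : 0 <= s by exact: sqrtr_ge0.
rewrite ler_pdivrMr//.
have -> : expR (a - b) * (a / b) * s * p = expR (a - b) * s * (a * p) / b by ring.
rewrite ler_pdivlMr// mulrC.
have aps0 : 0 <= expR (a - b) * s * (a * p).
  by rewrite !mulr_ge0 ?expR_ge0// ltW.
(* Both sides are nonnegative; squaring removes the root [s] and matches
   [euler_beta_ratio_upper]. *)
rewrite -ler_sqr ?nnegrE ?aps0 ?(mulr_ge0 (ltW b0) (ltW q0))//.
move: h; rewrite ler_pdivrMr// => /le_trans; apply.
rewrite [in leRHS]exprMn [in leRHS]exprMn s2 -expRM_natl le_eqVlt.
apply/orP; left; apply/eqP.
rewrite (_ : - (2 * (b - a)) = 2%:R * (a - b)); last by ring.
by field; rewrite gt_eqF.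
Qed.
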